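(* Let $V$ be a finite vocabulary and let $P$ be a probability distribution on $V$. Let $g_{\mathrm{SynthID}}(P)=\frac34-\frac14\sum_{x\in V}P(x)^2$ be the expected green ratio of the single-layer SynthID watermark. Then $$g_{\mathrm{SynthID}}(P)\ \le\ \frac34-\frac14\exp\big(-H(P)\big),$$ where $H(P)$ is the Shannon entropy of $P$.
   Context: $V$ is a finite nonempty set, and $P$ represents a language model's next-token distribution given a prefix. Shannon entropy is $H(P)=-\sum_{x\in V}P(x)\log P(x)$ (natural logarithm, $0\log 0=0$). The expected green ratio of a watermark is the expected (over the key) probability that the token sampled from the watermarked version of $P$ lies in the key's ''green list'' subset of $V$; for single-layer SynthID it is given by the closed form stated in the claim. *)

(* Defs.v *)
From mathcomp Require Import all_boot all_order all_algebra.
From mathcomp Require Import reals sequences exp.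

Set Implicit Arguments.
Unset Strict Implicit.
Unset Printing Implicit Defensive.

Import Order.TTheory GRing.Theory Num.Theory.
Local Open Scope ring_scope.

(* The normalization condition forces V to be nonempty. *)
Definition is_distr (R : realType) (V : finType) (P : V -> R) : Prop :=
  (forall x, 0 <= P x) /\ \sum_(x : V) P x = 1.

(* The factor P x kills the terms with P x = 0 whatever the value of ln 0,
   which is the convention 0 log 0 = 0. *)
Definition shannon_entropy (R : realType) (V : finType) (P : V -> R) : R :=
  - \sum_(x : V) P x * ln (P x).

(* Closed form of the expected (over the key) probability that the token
   sampled from the single-layer SynthID watermarked version of P is green. *)
Definition green_SynthID (R : realType) (V : finType) (P : V -> R) : R :=
  3 / 4 - 1 / 4 * \sum_(x : V) P x ^+ 2.

(* Main.v *)
Require Import Defs.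
From mathcomp Require Import all_boot all_order all_algebra.
From mathcomp Require Import reals sequences exp.

Set Implicit Arguments.
Unset Strict Implicit.
Unset Printing Implicit Defensive.

Import Order.TTheory GRing.Theory Num.Theory.
Local Open Scope ring_scope.

(** By Jensen's inequality for [expR] under the weights [P],
    exp(- H(P)) = exp(sum P ln P) <= sum P exp(ln P) = sum P^2. *)

(** The green ratio decreases in the collision probability [\sum P x ^+ 2], so the claim is that
    collision entropy is at most Shannon entropy: Jensen with [f x = ln (P x)]. *)

(* Average over [P] the tangent line of [expR] at the mean of [f]. *)
Lemma expR_jensen (R : realType) (V : finType) (P f : V -> R) :
  is_distr P ->
  expR (\sum_(x : V) P x * f x) <= \sum_(x : V) P x * expR (f x).
Proof.
move=> [P_ge0 P_sum1]; set m := \sum_(x : V) P x * f x.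
have tangent x : expR m * (1 + (f x - m)) <= expR (f x).
  rewrite -[leRHS](congr1 expR (subrKC m (f x))) expRD.
  by rewrite ler_wpM2l ?expR_ge0 ?expR_ge1Dx.
(* The linear terms average out: [P] has mass 1 and [m] is the mean of [f]. *)
have -> : expR m = \sum_(x : V) P x * (expR m * (1 + (f x - m))).
  under eq_bigr => x _ do rewrite mulrCA mulrDr mulr1 mulrBr.
  by rewrite -mulr_sumr big_split /= sumrB -mulr_suml P_sum1 mul1r subrr addr0 mulr1.
by apply: ler_sum => x _; rewrite ler_wpM2l.
Qed.

Theorem mainTheorem5 (R : realType) (V : finType) (P : V -> R)
    (hP : is_distr P) :
  green_SynthID P <= 3 / 4 - 1 / 4 * expR (- shannon_entropy P).
Proof.
rewrite /green_SynthID /shannon_entropy opprK lerB // ler_wpM2l ?divr_ge0 //.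
apply: le_trans (expR_jensen _ hP) _; apply: ler_sum => x _.
(* [expR (ln (P x))] is [P x] only when [P x > 0]; at [P x = 0] the weight makes both sides 0. *)
have := hP.1 x; rewrite le_eqVlt => /predU1P[<-|Px_gt0].
  by rewrite mul0r expr0n.
by rewrite lnK // expr2.
Qed.
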